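(* Welded graphs with no marked vertex are in one-to-one correspondence (vertices corresponding to generators, and $w$-decorated edges from $x_i$ to $x_j$ corresponding to relations $\overline x_jx_i^w$) with Wirtinger presentations up to the following operations: - $\langle x_1,\ldots,x_k\mid R_1,\ldots,R_s,\overline x_{i_2}x_{i_1}\rangle\leftrightarrow\langle x_1,\ldots,x_{i_2-1},x_{i_2+1},\ldots,x_k\mid {R_1}_{|x_{i_2}\to x_{i_1}},\ldots,{R_s}_{|x_{i_2}\to x_{i_1}}\rangle$; - $\langle x_1,\ldots,x_k\mid R_1,\ldots,R_s,\overline x_{i_1}x_{i_2}^w\rangle\leftrightarrow\langle x_1,\ldots,x_k\mid R_1,\ldots,R_s,\overline x_{i_2}x_{i_1}^{\overline w}\rangle$; - $\langle x_1,\ldots,x_k\mid R_1,\ldots,R_s\rangle\leftrightarrow\langle x_1,\ldots,x_k\mid {R_1}_{|x_{i_1}\to x_{i_1}^\alpha},\ldots,{R_s}_{|x_{i_1}\to x_{i_1}^\alpha}\rangle$; - $\langle x_1,\ldots,x_k\mid R_1,\ldots,R_s,\overline x_{i_2}x_{i_1}^w,\overline x_{i_4}x_{i_3}^{x_{i_1}w}\rangle\leftrightarrow\langle x_1,\ldots,x_k\mid R_1,\ldots,R_s,\overline x_{i_2}x_{i_1}^w,\overline x_{i_4}x_{i_3}^{wx_{i_2}}\rangle$; where $R_{|a\to b}$ denotes the word obtained from the word $R$ by replacing all occurrences of $a$ by $b$, and where $\alpha$ is any generator or inverse of a generator.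
   Context: Notation: $\overline a=a^{-1}$, $a^b=\overline bab$. A Wirtinger presentation is a group presentation $\langle x_1,\ldots,x_k\mid R_1,\ldots,R_s\rangle$ with finitely many generators and finitely many relations of the form $R=\overline x_jx_i^w$, where $x_i,x_j$ are two generators and $w\in F(x_1,\ldots,x_k)$; relations are regarded as elements of the free group. In the first operation $i_1\ne i_2$. In the third operation, a relation resulting from the substitution is read as a relation of the form $\overline x_jx_i^{w'}$ after conjugation (e.g. $\overline{x_j^{\alpha}}\,x_i^{w}$ is read as $\overline x_jx_i^{w\overline\alpha}$). The order of generators and of components is disregarded. Welded graphs. A $w$-graph with no marked vertex is a finite oriented graph $\Gamma$ (loops and multiple edges allowed) with vertex set $V_\Gamma$, in which each edge carries a decoration in the free group $F(V_\Gamma)$ (an edge from $a$ to $b$ decorated by $w$ is written $(a,b,w)$). An edge decorated by $1$ is called empty. A welded graph with no marked vertex is a class of such $w$-graphs modulo the equivalence relation generated by: - contraction C: remove an empty edge $(a,b,1)$ with $a\neq b$ and identify $a$ and $b$ (also in all decorations); - orientation reversal OR: replace an edge $(a,b,w)$ by $(b,a,\overline w)$; - stabilization S: if all edges incident to $b$ are oriented outwards from $b$, and all edge decorations of $\Gamma$ lie in $F(V_\Gamma\setminus\{b\})$, add a common prefix $a$ (a vertex or the inverse of a vertex) to the decorations of all edges incident to $b$; - Reidemeister R1: replace an edge $(a,b,w)$ by $(a,b,a^{\varepsilon}w)$, $\varepsilon\in\{\pm1\}$; - Reidemeister R3: replace the decoration $aw$ of an edge $e$ by $wb$, provided $(a,b,w)$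 is an edge other than $e$.
   Formalization: Each Wirtinger relation is recorded with its two generators x_i, x_j, not only as an element of the free group; otherwise ⟨a,b|1,1⟩ would come from two inequivalent welded graphs (two loops at a, or one loop at each of a and b). *)

(* Defs.v *)
From HB Require Import structures.
From mathcomp Require Import all_boot.
From Stdlib Require Import Relation_Operators.

Set Implicit Arguments.
Unset Strict Implicit.
Unset Printing Implicit Defensive.

Local Open Scope group_scope.

(* Letters over X: (false, x) stands for x and (true, x) for its inverse. *)
Notation letter X := (bool * X)%type.

Section Words.
Variable X : choiceType.
Implicit Types (l : letter X) (u v w : seq (letter X)).

Definition linv l : letter X := (~~ l.1, l.2).

Definition reduced w := sorted (fun l m => m != linv l) w.

Definition lcons l w :=
  if w is m :: w' then if m == linv l then w' else l :: w else [:: l].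

Definition wmul u v := foldr lcons v u.
Definition winv w := rev (map linv w).

Lemma linvK : involutive linv.
Proof. by case=> b x; rewrite /linv /= negbK. Qed.

Lemma reduced_behead l w : reduced (l :: w) -> reduced w.
Proof. by case: w => //= m w /andP[]. Qed.

Lemma lcons_reduced l w : reduced w -> reduced (lcons l w).
Proof.
case: w => [|m w] //= rw; case: eqP => [_|/eqP nm]; first exact: reduced_behead rw.
by rewrite /= nm.
Qed.

Lemma lcons_cons l w : reduced (l :: w) -> lcons l w = l :: w.
Proof. by case: w => //= m w /andP[/negPf-> _]. Qed.

Lemma lconsK l w : reduced w -> lcons (linv l) (lcons l w) = w.
Proof.
case: w => [|m w] /= => [_|rw]; first by rewrite linvK eqxx.
case: eqP => [ml|_]; first by rewrite -ml lcons_cons.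
by rewrite /= linvK eqxx.
Qed.

Lemma wmul_reduced u v : reduced v -> reduced (wmul u v).
Proof. by move=> rv; elim: u => //= l u IHu; apply: lcons_reduced. Qed.

Lemma wmul_lcons l u v :
  reduced v -> wmul (lcons l u) v = lcons l (wmul u v).
Proof.
case: u => [|m u] //= rv; case: eqP => [->|//].
have := lconsK (linv l) (wmul_reduced u rv).
by rewrite linvK => ->.
Qed.

Lemma wmulA u v w : reduced w -> wmul u (wmul v w) = wmul (wmul u v) w.
Proof. by move=> rw; elim: u => //= l u ->; rewrite wmul_lcons. Qed.

Lemma wmul0 u : reduced u -> wmul u [::] = u.
Proof.
elim: u => //= l u IHu ru; rewrite IHu ?lcons_cons //.
exact: reduced_behead ru.
Qed.

Lemma winv_reduced w : reduced w -> reduced (winv w).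
Proof.
rewrite /reduced /winv rev_sorted sorted_map.
case: w => //= l w; apply: sub_path => m n nm.
by rewrite /= linvK; apply: contra nm => /eqP->.
Qed.

Lemma wmulVw w : wmul (winv w) w = [::].
Proof.
elim: w => //= l w IHw; rewrite /wmul /winv /= rev_cons -cats1 foldr_cat /= linvK eqxx.
exact: IHw.
Qed.

Lemma winvK : involutive winv.
Proof.
by move=> w; rewrite /winv map_rev revK -map_comp map_id_in // => l _ /=; rewrite linvK.
Qed.

Lemma wmulwV w : wmul w (winv w) = [::].
Proof. by rewrite -{1}(winvK w) wmulVw. Qed.

End Words.

(* The free group F(X), as the set of reduced words over X. *)
Record freegroup (X : choiceType) := FreeGroup {
  fword :> seq (letter X);
  fwordP : reduced fword
}.

Section FreeGroup.
Variable X : choiceType.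
HB.instance Definition _ := [isSub for @fword X].
HB.instance Definition _ := [Choice of freegroup X by <:].

Implicit Types u v w : freegroup X.

Definition fone := @FreeGroup X [::] isT.
Definition fmul u v := FreeGroup (wmul_reduced u (fwordP v)).
Definition finv u := FreeGroup (winv_reduced (fwordP u)).

Fact fmulA : associative fmul.
Proof. by move=> u v w; apply/val_inj/wmulA/fwordP. Qed.
Fact fmul1 : left_id fone fmul.
Proof. by move=> u; apply/val_inj. Qed.
Fact fmulr1 : right_id fone fmul.
Proof. by move=> u; apply/val_inj/wmul0/fwordP. Qed.
Fact fmulV : left_inverse fone finv fmul.
Proof. by move=> u; apply/val_inj/wmulVw. Qed.
Fact fmulrV : right_inverse fone finv fmul.
Proof. by move=> u; apply/val_inj/wmulwV. Qed.

HB.instance Definition _ :=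
  isGroup.Build (freegroup X) fmulA fmul1 fmulr1 fmulV fmulrV.

Definition gen (x : X) : freegroup X := @FreeGroup X [:: (false, x)] isT.

End FreeGroup.

Definition lval (X : choiceType) (G : groupType) (f : X -> G) (l : letter X) :=
  if l.1 then (f l.2)^-1 else f l.2.

Definition glet (X : choiceType) (l : letter X) : freegroup X := lval (@gen X) l.

Section Lift.
Variables (X : choiceType) (G : groupType) (f : X -> G).

(* The morphism F(X) -> G sending each generator x to f x. *)
Definition lift_free (w : freegroup X) : G := \prod_(l <- fword w) lval f l.

Lemma lift_gen x : lift_free (gen x) = f x.
Proof. by rewrite /lift_free big_seq1. Qed.

Fact lift_free_morphism : monoid_morphism lift_free.
Proof.
split=> [|[u ru] [v rv]]; first by rewrite /lift_free big_nil.
rewrite /lift_free /=; elim: u {ru} => [|l u IHu] /=; first by rewrite big_nil mul1g.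
rewrite big_cons -mulgA -IHu; case: (wmul u v) => [|m w] /=.
  by rewrite big_seq1 big_nil mulg1.
case: eqP => [->|_]; last by rewrite !big_cons.
rewrite big_cons mulgA; case: l => [[] x]; rewrite /lval /linv /=.
  by rewrite mulVg mul1g.
by rewrite mulgV mul1g.
Qed.

HB.instance Definition _ :=
  isUMagmaMorphism.Build (freegroup X) G lift_free lift_free_morphism.

End Lift.

Definition rename (X Y : choiceType) (f : X -> Y) : freegroup X -> freegroup Y :=
  lift_free (fun x => gen (f x)).

(* w belongs to the subgroup F(X \ {b}) *)
Definition avoids (X : choiceType) (b : X) (w : freegroup X) :=
  b \notin [seq l.2 | l <- fword w].

(* The classes of a relation R, meant to be an equivalence relation. *)
Definition classes (T : Type) (R : T -> T -> Prop) :=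
  {C : T -> Prop | exists x, C = R x}.

Definition in_class (T : Type) (R : T -> T -> Prop) (x : T) (c : classes R) : Prop :=
  sval c x.

(* (a, b, w) is the edge from a to b decorated by w; graphs carry a list of
   edges, so that multiple edges are allowed, whose order is forgotten by
   [Wiso]. *)
Definition edge (V : choiceType) := (V * V * freegroup V)%type.

Definition edge_map (V W : choiceType) (f : V -> W) (e : edge V) : edge W :=
  (f e.1.1, f e.1.2, rename f e.2).

Record wgraph := WGraph { vertex : finType; edges : seq (edge vertex) }.

Definition prefix_at (V : choiceType) (b : V) (u : freegroup V) (e : edge V) : edge V :=
  (e.1, if e.1.1 == b then u * e.2 else e.2).

Inductive wgraph_move : wgraph -> wgraph -> Prop :=
| Wiso (V W : finType) (E : seq (edge V)) (E' : seq (edge W)) (f : V -> W) :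
    bijective f -> perm_eq E' [seq edge_map f e | e <- E] ->
    wgraph_move (WGraph E) (WGraph E')
(* p is the quotient map identifying a and b *)
| WC (V W : finType) (a b : V) (E : seq (edge V)) (p : V -> W) :
    a != b ->
    (forall y, exists x, p x = y) ->
    (forall x y, p x = p y <->
       [\/ x = y, x = a /\ y = b | x = b /\ y = a]) ->
    wgraph_move (WGraph ((a, b, 1) :: E)) (WGraph [seq edge_map p e | e <- E])
| WOR (V : finType) (a b : V) (w : freegroup V) (E : seq (edge V)) :
    wgraph_move (WGraph ((a, b, w) :: E)) (WGraph ((b, a, w^-1) :: E))
| WS (V : finType) (b : V) (a : letter V) (E : seq (edge V)) :
    (forall e, e \in E -> e.1.2 != b) ->
    (forall e, e \in E -> avoids b e.2) ->
    wgraph_move (WGraph E) (WGraph [seq prefix_at b (glet a) e | e <- E])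
| WR1 (V : finType) (a b : V) (w : freegroup V) (eps : bool) (E : seq (edge V)) :
    wgraph_move (WGraph ((a, b, w) :: E))
                (WGraph ((a, b, glet (eps, a) * w) :: E))
| WR3 (V : finType) (a b c d : V) (w : freegroup V) (E : seq (edge V)) :
    wgraph_move (WGraph [:: (a, b, w), (c, d, gen a * w) & E])
                (WGraph [:: (a, b, w), (c, d, w * gen b) & E]).

Definition wgraph_equiv := clos_refl_sym_trans wgraph wgraph_move.

Definition welded_graph := classes wgraph_equiv.

(* A Wirtinger relation (x_i, x_j, R) is an element R = x_j^-1 x_i^w of the
   free group, together with the two generators x_i and x_j. These cannot be
   left out: R does not determine them when i = j, since for instance
     x^-1 x^1 = 1 = y^-1 y^1  and  x^-1 x^(y^-1) = y^-1 y^(x y^-1),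
   and a loop at x is not interchangeable with a loop at y. On the other hand
   w is not part of the data: x_j^-1 x_i^w and x_j^-1 x_i^(x_i w) are the same
   relation. *)
Definition wrelation (X : choiceType) := (X * X * freegroup X)%type.

Definition wrel (X : choiceType) (i j : X) (w : freegroup X) : wrelation X :=
  (i, j, (gen j)^-1 * gen i ^ w).

Definition rel_rename (X Y : choiceType) (f : X -> Y) (r : wrelation X) : wrelation Y :=
  (f r.1.1, f r.1.2, rename f r.2).

(* The relations form a list (repetitions matter) whose order is forgotten by
   [Psort]. *)
Record wpres := WPres {
  ngen : nat;
  rels : seq (wrelation 'I_ngen);
  relsP : forall r, r \in rels -> exists w, r = wrel r.1.1 r.1.2 w
}.

(* The substitution x_b -> x_b^u *)
Definition conj_gen (X : choiceType) (b : X) (u : freegroup X) :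
    freegroup X -> freegroup X :=
  lift_free (fun x => if x == b then gen x ^ u else gen x).

(* The result of x_b -> x_b^u on a relation (x_i, x_j, R); when j = b it is
   conjugated by u^-1 to be again of the form x_j^-1 x_i^w'. *)
Definition rel_conj_gen (X : choiceType) (b : X) (u : freegroup X)
    (r : wrelation X) : wrelation X :=
  (r.1, conj_gen b u r.2 ^ (if r.1.2 == b then u^-1 else 1)).

Lemma rel_conj_gen_wrel (X : choiceType) (b i j : X) (u w : freegroup X) :
  rel_conj_gen b u (wrel i j w) =
  wrel i j ((if i == b then u else 1) * conj_gen b u w *
            (if j == b then u^-1 else 1)).
Proof.
rewrite /rel_conj_gen /wrel /=; congr (_, _).
have phiX x : conj_gen b u (gen x) = gen x ^ (if x == b then u else 1).
  by rewrite /conj_gen lift_gen; case: eqP => _; rewrite ?conjg1.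
have phiM : {morph conj_gen b u : x y / x * y}.
  by move=> x y; rewrite /conj_gen gmulfM.
have phiV : {morph conj_gen b u : x / x^-1}.
  by move=> x; rewrite /conj_gen gmulfV.
rewrite /conjg !(phiM, phiV) !phiX -/(conjg _ _).
case: (i == b); case: (j == b);
  by rewrite /conjg ?invgM ?invgK ?invg1 ?mulg1 ?mul1g ?mulgA ?mulgV ?mul1g.
Qed.

Inductive wpres_move : wpres -> wpres -> Prop :=
| Psort k (r s : seq (wrelation 'I_k)) hr hs (f : 'I_k -> 'I_k) :
    bijective f -> perm_eq s [seq rel_rename f q | q <- r] ->
    wpres_move (@WPres k r hr) (@WPres k s hs)
(* s is the list of the relations r with x_i2 replaced by x_i1, seen as words
   in the generators other than x_i2; these are renumbered along [lift i2]. *)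
| Pmerge k (i1 i2 : 'I_k.+1) (r : seq (wrelation 'I_k.+1))
    (s : seq (wrelation 'I_k)) hr hs :
    i1 != i2 ->
    [seq rel_rename (lift i2) q | q <- s] =
    [seq rel_rename (fun x => if x == i2 then i1 else x) q | q <- r] ->
    wpres_move (@WPres k.+1 (wrel i1 i2 1 :: r) hr) (@WPres k s hs)
| Pflip k (i1 i2 : 'I_k) (w : freegroup 'I_k) (r : seq (wrelation 'I_k)) hr hs :
    wpres_move (@WPres k (wrel i2 i1 w :: r) hr)
               (@WPres k (wrel i1 i2 w^-1 :: r) hs)
| Pconj k (i1 : 'I_k) (alpha : letter 'I_k) (r : seq (wrelation 'I_k)) hr hs :
    wpres_move (@WPres k r hr)
               (@WPres k [seq rel_conj_gen i1 (glet alpha) q | q <- r] hs)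
| Pslide k (i1 i2 i3 i4 : 'I_k) (w : freegroup 'I_k)
    (r : seq (wrelation 'I_k)) hr hs :
    wpres_move (@WPres k [:: wrel i1 i2 w, wrel i3 i4 (gen i1 * w) & r] hr)
               (@WPres k [:: wrel i1 i2 w, wrel i3 i4 (w * gen i2) & r] hs).

Definition wpres_equiv := clos_refl_sym_trans wpres wpres_move.

Definition wirtinger_class := classes wpres_equiv.

(* Some numbering of the vertices turns the edges of G into the relations of P. *)
Definition corresponds (G : wgraph) (P : wpres) : Prop :=
  exists2 nu : vertex G -> 'I_(ngen P), bijective nu &
    perm_eq (rels P) [seq wrel (nu e.1.1) (nu e.1.2) (rename nu e.2) | e <- edges G].

(* Main.v *)
Require Import Defs.
From mathcomp Require Import all_boot.
From mathcomp.classical Require Import boolp.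
From Stdlib Require Import Relation_Operators.

(** Sending an edge (a, b, w) to the relation b^-1 a^w turns each move on graphs
    into an operation on presentations: contraction into merging, orientation
    reversal into flipping, R3 into sliding, and R1 into nothing at all, since
    a^(a w) = a^w.  A stabilization at b is the substitution b -> b^u in the
    special case where b is the target of no edge and occurs in no decoration.
    Two points are needed to go back.

    The decoration is not determined by the relation: a^w = a^w' means that
    w' w^-1 commutes with the generator a.  Centralizers of generators in a free
    group are cyclic ([centraliser_gen]), so w' = a^n w and R1 relates the two
    edges ([graph_rel_edge]).

    A general substitution b -> b^u must be obtained from the much more
    restrictive stabilization ([graph_conj]).  An edge decorated by u v can be
    subdivided into two edges decorated by u and v ([graph_split]), so R3, which
    acts on whole decorations, can be applied to factors of decorations:
    an edge (a, b, w) lets one replace b by a^w in all the other decorations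
    ([graph_subst]).  To substitute b^u for b, with u not involving b,
    hang a new vertex c on b by an empty edge, stabilize at c so that the edge
    reads b = c^u, and replace b by c^u in all decorations.
    Now no decoration involves b; if no edge of the original graph ended
    in b, then stabilizing at b makes the edge between b and c empty again, and
    contracting it leaves the expected graph ([graph_conj_out]).  Edges ending
    in b are first subdivided so that they no longer do.  When u is b^(+-1), the
    substitution is the identity on words, and R1 is enough.

    These facts make the correspondence total on both sides and compatible with
    the two equivalence relations in both directions, which is all that
    a bijection between the classes requires ([class_bijection]). *)

Set Implicit Arguments.
Unset Strict Implicit.
Unset Printing Implicit Defensive.

Local Open Scope group_scope.

(** * Free groups *)

Section Words.
Variable X : choiceType.
Implicit Types (l : letter X) (u v w : freegroup X).

Lemma fword_glet l : fword (glet l) = [:: l].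
Proof. by case: l => [[] x]. Qed.

(** The equation on words says that multiplying by l cancels nothing, which is what
    lets hypotheses on the letters of a word pass to its tail. *)
Lemma freegroup_ind (P : freegroup X -> Prop) :
  P 1 ->
  (forall l w, fword (glet l * w) = l :: fword w -> P w -> P (glet l * w)) ->
  forall w, P w.
Proof.
move=> P1 PM [s]; elim: s => [|l s IHs] rs.
  by rewrite (_ : FreeGroup rs = 1) //; apply: val_inj.
have rs' := reduced_behead rs.
have E : fword (glet l * FreeGroup rs') = l :: s.
  by rewrite /= fword_glet /= lcons_cons.
by rewrite (_ : FreeGroup rs = glet l * FreeGroup rs'); [apply: PM | apply: val_inj].
Qed.

Lemma lift_freeM (G : groupType) (f : X -> G) : {morph lift_free f : u v / u * v}.
Proof. exact: gmulfM. Qed.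
Lemma lift_freeV (G : groupType) (f : X -> G) : {morph lift_free f : u / u^-1}.
Proof. exact: gmulfV. Qed.
Lemma lift_free1 (G : groupType) (f : X -> G) : lift_free f 1 = 1.
Proof. exact: gmulf1. Qed.

(** The uniqueness half of the universal property of F(X). *)
Lemma lift_free_eq (G : groupType) (f : X -> G) (phi : freegroup X -> G) :
    phi 1 = 1 -> {morph phi : u v / u * v} -> (forall x, phi (gen x) = f x) ->
  forall w, phi w = lift_free f w.
Proof.
move=> phi1 phiM phiX.
have phiV u : phi u^-1 = (phi u)^-1.
  by apply: (mulgI (phi u)); rewrite -phiM !mulgV.
elim/freegroup_ind => [|[b x] w _ IHw]; first by rewrite phi1 lift_free1.
rewrite phiM lift_freeM IHw /glet /lval /=.
by case: b; rewrite ?lift_freeV ?phiV phiX lift_gen.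
Qed.

Lemma lift_free_ext (G : groupType) (f g : X -> G) w :
  f =1 g -> lift_free f w = lift_free g w.
Proof.
move=> fg; apply: (@lift_free_eq _ _ (lift_free f)) => [||x].
- exact: lift_free1.
- exact: lift_freeM.
- by rewrite lift_gen.
Qed.

Lemma lift_free_gen w : lift_free (@gen X) w = w.
Proof. by symmetry; apply: (@lift_free_eq _ _ id). Qed.

End Words.

Section Rename.
Variables X Y Z : choiceType.
Implicit Types (f : X -> Y) (u v w : freegroup X).

Lemma lift_free_rename (G : groupType) f (g : Y -> G) w :
  lift_free g (rename f w) = lift_free (g \o f) w.
Proof.
apply: (@lift_free_eq _ _ _ (fun w => lift_free g (rename f w))) => [|u v|x].
- by rewrite /rename !lift_free1.
- by rewrite /rename !lift_freeM.
- by rewrite /rename !lift_gen.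
Qed.

Lemma rename_comp f (g : Y -> Z) w : rename g (rename f w) = rename (g \o f) w.
Proof. exact: lift_free_rename. Qed.

Lemma rename_id (h : X -> X) w : h =1 id -> rename h w = w.
Proof.
by move=> hid; rewrite -[RHS]lift_free_gen; apply: lift_free_ext => x; rewrite hid.
Qed.

Lemma rename_lift_free f (g : Z -> freegroup X) (w : freegroup Z) :
  rename f (lift_free g w) = lift_free (fun x => rename f (g x)) w.
Proof.
apply: (@lift_free_eq _ _ _ (fun z => rename f (lift_free g z))) => [|u v|x].
- by rewrite /rename !lift_free1.
- by rewrite /rename !lift_freeM.
- by rewrite !lift_gen.
Qed.

Lemma renameM f : {morph rename f : u v / u * v}.
Proof. exact: lift_freeM. Qed.
Lemma renameV f : {morph rename f : u / u^-1}.
Proof. exact: lift_freeV. Qed.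
Lemma rename1 f : rename f 1 = 1.
Proof. exact: lift_free1. Qed.
Lemma rename_gen f x : rename f (gen x) = gen (f x).
Proof. exact: lift_gen. Qed.

End Rename.

Lemma rename_glet (V W : choiceType) (f : V -> W) l : rename f (glet l) = glet (l.1, f l.2).
Proof. by case: l => [[] x]; rewrite /glet /lval /= ?renameV rename_gen. Qed.

Section Avoids.
Variables X Y : choiceType.
Implicit Types (b : X) (u v w : freegroup X).

Lemma avoidsE b w : avoids b w = all (fun l => l.2 != b) (fword w).
Proof.
rewrite /avoids; elim: (fword w) => //= l s <-.
by rewrite inE negb_or eq_sym.
Qed.

Lemma avoidsM b u v : avoids b u -> avoids b v -> avoids b (u * v).
Proof.
rewrite !avoidsE /= /wmul => + bv; elim: (fword u) => [|l s IHs] /=; first by move=> _.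
move=> /andP[bl /IHs]; rewrite -/(wmul s v).
case: (wmul s v) => [|m t] /=; first by rewrite bl.
by case: (m == linv l) => [/andP[]|] //= ->; rewrite bl.
Qed.

Lemma avoidsV b u : avoids b u -> avoids b u^-1.
Proof. by rewrite !avoidsE /= /winv all_rev all_map. Qed.

Lemma avoids_gen b x : avoids b (gen x) = (x != b).
Proof. by rewrite avoidsE /= andbT. Qed.

Lemma avoids_lift b (f : Y -> freegroup X) (w : freegroup Y) :
  (forall y, avoids b (f y)) -> avoids b (lift_free f w).
Proof.
move=> bf; elim/freegroup_ind: w => [|[e y] w _ IHw]; first by rewrite lift_free1.
rewrite lift_freeM avoidsM // /glet /lval /=; case: e; rewrite ?lift_freeV lift_gen //.
exact: avoidsV.
Qed.

Lemma conj_gen_avoids b u w : avoids b w -> conj_gen b u w = w.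
Proof.
elim/freegroup_ind: w => [_|[e x] w Ew IHw]; first exact: lift_free1.
rewrite {1}avoidsE Ew /= -avoidsE => /andP[/negPf xb /IHw bw].
rewrite /conj_gen lift_freeM -/(conj_gen b u w) bw /glet /lval /=.
by case: e {Ew}; rewrite ?lift_freeV lift_gen xb.
Qed.

End Avoids.

Lemma avoids_rename_inj (X Y : choiceType) (f : X -> Y) (b : X) w :
  injective f -> avoids b w -> avoids (f b) (rename f w).
Proof.
move=> f_inj; elim/freegroup_ind: w => [|l w Ew IHw]; first by rewrite rename1.
rewrite avoidsE Ew /= -avoidsE => /andP[lb /IHw bw].
rewrite renameM avoidsM //; case: l lb {Ew} => [[] x] /= xb;
by rewrite /glet /lval /= ?renameV rename_gen ?avoidsV // avoids_gen (inj_eq f_inj).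
Qed.

(** * Centralizers of generators *)

Section Centralizer.
Variable X : choiceType.
Implicit Types (x : X) (s t : seq (letter X)) (u v w : freegroup X).

Lemma wmul_cat s t : reduced (s ++ t) -> wmul s t = s ++ t.
Proof.
by elim: s => //= l s IHs rs; rewrite IHs ?lcons_cons //; apply: reduced_behead rs.
Qed.

(** Strip the letters x and x^-1 from the head of v: what remains still commutes
    with x.  If it were a nonempty word t, then t^-1 x t would be reduced as written,
    hence longer than x. *)
Lemma centraliser_gen x v : gen x ^ v = gen x ->
  all (fun l => l.2 == x) (fword v).
Proof.
have noC l (t : freegroup X) : fword (glet l * t) = l :: fword t -> l.2 != x ->
   gen x ^ (glet l * t) <> gen x.
  move=> Et lx.
  suff E : fword (gen x ^ (glet l * t)) =
      winv (fword (glet l * t)) ++ (false, x) :: fword (glet l * t).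
    move=> /(congr1 (@fword X)) /(congr1 size); rewrite E Et size_cat /=.
    by rewrite !addnS.
  have xt e : reduced ((e, x) :: fword (glet l * t)).
    have := fwordP (glet l * t).
    rewrite Et /= => ->; rewrite andbT; apply: contra lx.
    by case: l {Et} => b y /eqP[_ ->].
  have xtE : fword (gen x * (glet l * t)) = (false, x) :: fword (glet l * t).
    exact: lcons_cons (xt false).
  rewrite -xtE; apply: wmul_cat; rewrite xtE /reduced sorted_cat_cons.
  apply/andP; split; last exact: (xt false).
  (* t^-1 x is the inverse of x^-1 t, which is reduced. *)
  by have := winv_reduced (xt true); rewrite {1}/winv /= rev_cons.
elim/freegroup_ind: v => [//|l t Et IHt lt].
have [lx|/eqP lx] := l.2 =P x; last by case: (noC l t Et lx lt).
rewrite Et /= lx eqxx IHt // -{2}lt conjgM; congr (_ ^ _); apply: esym.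
apply/conjg_fixP/commgP; case: l lx {Et lt} => [[] y] /= ->.
  by apply: commuteV.
by [].
Qed.
End Centralizer.

(** * Elementary moves on graphs and subdivision of edges *)

Infix "~~>" := wgraph_equiv (at level 70).

Lemma gstep G H : wgraph_move G H -> G ~~> H.
Proof. exact: rst_step. Qed.
Lemma grefl G : G ~~> G.
Proof. exact: rst_refl. Qed.
Lemma gsym G H : G ~~> H -> H ~~> G.
Proof. exact: rst_sym. Qed.
Lemma gtrans H G K : G ~~> H -> H ~~> K -> G ~~> K.
Proof. exact: rst_trans. Qed.

#[local] Hint Resolve grefl : core.

Lemma edge_map_comp (U V W : choiceType) (f : U -> V) (g : V -> W) e :
  edge_map g (edge_map f e) = edge_map (g \o f) e.
Proof. by case: e => [[a b] w]; rewrite /edge_map /= rename_comp. Qed.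

Lemma edge_map_id (V : choiceType) (f : V -> V) e : f =1 id -> edge_map f e = e.
Proof. by case: e => [[a b] w] fid; rewrite /edge_map /= !fid rename_id. Qed.

Lemma eq_edge_map (V W : choiceType) (f g : V -> W) e :
  f =1 g -> edge_map f e = edge_map g e.
Proof.
move=> fg; case: e => [[i j] w]; rewrite /edge_map /= !fg; congr (_, _).
by apply: lift_free_ext => x; rewrite fg.
Qed.

Lemma map_edge_mapK (U V : choiceType) (f : U -> V) (g : V -> U) (E : seq (edge U)) :
  cancel f g -> [seq edge_map g e | e <- [seq edge_map f e | e <- E]] = E.
Proof.
by move=> fK; rewrite -map_comp map_id_in // => e _ /=; rewrite edge_map_comp edge_map_id.
Qed.

Section LocalMoves.
Implicit Types V W : finType.

Lemma graph_perm V (E F : seq (edge V)) : perm_eq E F -> WGraph E ~~> WGraph F.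
Proof.
move=> EF; apply/gstep/(@Wiso _ _ _ _ id); first by exists id.
have -> : [seq edge_map id e | e <- E] = E by apply: map_id_in => e _; apply: edge_map_id.
by rewrite perm_sym.
Qed.

(** Rewriting edges one at a time; K holds the edges that each step relies on and
    that must therefore stay in place. *)
Lemma graph_map V (K : seq (edge V)) (h : edge V -> edge V) E F :
    (forall e F, e \in E -> WGraph (K ++ e :: F) ~~> WGraph (K ++ h e :: F)) ->
  WGraph (K ++ E ++ F) ~~> WGraph (K ++ map h E ++ F).
Proof.
elim: E F => //= e E IHE F hE.
apply: gtrans (hE e _ (mem_head _ _)) _.
have pm (e' : edge V) (S : seq (edge V)) : perm_eq (K ++ e' :: S ++ F) (K ++ S ++ e' :: F).
  by rewrite perm_cat2l perm_sym perm_catC /= perm_cons perm_catC.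
apply: gtrans (graph_perm (pm _ _)) _.
apply: gtrans _ (gsym (graph_perm (pm _ _))).
by apply: IHE => e' F' e'E; apply: hE; rewrite inE e'E orbT.
Qed.

(** Read from right to left, this introduces a new vertex hanging on v by an empty
    edge, each occurrence of v being freely kept or moved to the new vertex. *)
Lemma uncontract V (v : V) (E : seq (edge (option V))) :
  WGraph ((None, Some v, 1) :: E) ~~> WGraph [seq edge_map (odflt v) e | e <- E].
Proof.
apply/gstep/WC => // [y|x y]; first by exists (Some y).
split=> [|[->|[-> ->]|[-> ->]]] //.
case: x y => [x|] [y|] /= => [->|->|->|_]; by [constructor 1|constructor 2|constructor 3].
Qed.

Lemma graph_flip V (a b : V) w E : WGraph ((a, b, w) :: E) ~~> WGraph ((b, a, w^-1) :: E).
Proof. exact/gstep/WOR. Qed.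

Lemma graph_swap V (e f : edge V) E : WGraph [:: e, f & E] ~~> WGraph [:: f, e & E].
Proof. by apply: graph_perm; apply/permPl/(perm_catCA [:: e] [:: f]). Qed.

Lemma graph_flip2 V e (a b : V) w E :
  WGraph [:: e, (a, b, w) & E] ~~> WGraph [:: e, (b, a, w^-1) & E].
Proof.
by apply: gtrans (graph_swap _ _ _) (gtrans (graph_flip _ _ _ _) (graph_swap _ _ _)).
Qed.

Lemma prefix_at1 (V : choiceType) (b : V) e : prefix_at b 1 e = e.
Proof. by case: e => [[c d] w]; rewrite /prefix_at mul1g; case: ifP. Qed.

Lemma prefix_atM (V : choiceType) (b : V) u v e :
  prefix_at b (u * v) e = prefix_at b u (prefix_at b v e).
Proof. by case: e => [[c d] w]; rewrite /prefix_at /= -mulgA; case: ifP. Qed.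

Lemma prefix_at_neq (V : choiceType) (b : V) u e : e.1.1 != b -> prefix_at b u e = e.
Proof. by case: e => [[c d] w]; rewrite /prefix_at => /= /negPf->. Qed.

Lemma stabilize V (b : V) u (E : seq (edge V)) :
    avoids b u ->
    {in E, forall e, e.1.2 != b} -> {in E, forall e, avoids b e.2} ->
  WGraph E ~~> WGraph [seq prefix_at b u e | e <- E].
Proof.
move=> + Eb EA; elim/freegroup_ind: u => [_|l u Eu IHu].
  by rewrite map_id_in // => e _; apply: prefix_at1.
rewrite avoidsE Eu /= -avoidsE => /andP[_ bu]; apply: gtrans (IHu bu) _.
rewrite (eq_map (prefix_atM b (glet l) u)) (map_comp (prefix_at b (glet l))).
apply: gstep; apply: WS => _ /mapP[e eE ->] /=; first exact: Eb.
by case: ifP => _; rewrite ?avoidsM ?EA.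
Qed.

Lemma avoids_None (V : choiceType) (w : freegroup V) : avoids None (rename Some w).
Proof. by apply: avoids_lift => x; rewrite avoids_gen. Qed.

(** Cut off an empty edge at the target j; at the new vertex both edges point
    outwards once one is reversed, and no decoration mentions this vertex, so that
    stabilization can move v from one edge to the other. *)
Lemma graph_split V (i j : V) u v F :
  WGraph ((i, j, u * v) :: F) ~~>
  WGraph [:: (Some i, None, rename Some u), (None, Some j, rename Some v)
           & [seq edge_map Some e | e <- F]].
Proof.
set F' := map _ F; pose uv' := rename Some (u * v).
have -> : (i, j, u * v) :: F = map (edge_map (odflt j)) ((Some i, None, uv') :: F').
  by rewrite /= map_edge_mapK // /edge_map /= rename_comp rename_id.
apply: gtrans (gsym (uncontract _ _)) _.
apply: gtrans (graph_flip2 _ _ _ _ _) _.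
apply: gtrans (stabilize (avoids_None v) _ _) _.
- by move=> e; rewrite !inE => /or3P[/eqP->|/eqP->|/mapP[? _ ->]].
- move=> e; rewrite !inE => /or3P[/eqP->|/eqP->|/mapP[? _ ->]] //=; last exact: avoids_None.
  exact/avoidsV/avoids_None.
rewrite /= [map _ F']map_id_in; last by move=> e /mapP[f _ ->]; rewrite prefix_at_neq.
rewrite /prefix_at /= mulg1 /uv' renameM invgM mulVKg.
apply: gtrans (graph_swap _ _ _) _.
by apply: gtrans (graph_flip _ _ _ _) _; rewrite invgK.
Qed.
End LocalMoves.

(** * Substituting b by its expression along an edge *)

Section Sliding.
Implicit Types V : finType.

(** R3 replaces a decoration a w by w b as a whole.  Isolating it as an edge of its own
    by subdividing first on the right, then on the left, makes it apply inside a
    longer decoration. *)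
Lemma slide V (a b c d : V) (w p q : freegroup V) F :
  WGraph [:: (a, b, w), (c, d, p * gen b * q) & F] ~~>
  WGraph [:: (a, b, w), (c, d, p * gen a ^ w * q) & F].
Proof.
have suffix (U : finType) (a' b' c' d' : U) (w' q' : freegroup U) F' :
    WGraph [:: (a', b', w'), (c', d', w' * gen b' * q') & F'] ~~>
    WGraph [:: (a', b', w'), (c', d', gen a' * w' * q') & F'].
  apply: gtrans (graph_swap _ _ _) _; apply: gtrans (graph_split _ _ _ _ _) _.
  apply: gtrans _ (graph_swap _ _ _); apply: gtrans _ (gsym (graph_split _ _ _ _ _)).
  have pm (e f g : edge (option U)) E : perm_eq [:: f, g, e & E] [:: e, f, g & E].
    by rewrite perm_sym; apply/permPl; apply: (perm_catCA [:: e] [:: f; g]).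
  rewrite /= !renameM !rename_gen.
  apply: gtrans (graph_perm (pm _ _ _ _)) (gtrans _ (gsym (graph_perm (pm _ _ _ _)))).
  exact/gsym/gstep/WR3.
have -> : p * gen b * q = (p * w^-1) * (w * gen b * q) by rewrite !mulgA mulgVK.
have -> : p * gen a ^ w * q = (p * w^-1) * (gen a * w * q) by rewrite conjgE !mulgA.
apply: gtrans (graph_swap _ _ _) _; apply: gtrans (graph_split _ _ _ _ _) _.
apply: gtrans _ (graph_swap _ _ _); apply: gtrans _ (gsym (graph_split _ _ _ _ _)).
have pm (e f g : edge (option V)) E : perm_eq [:: f, g, e & E] [:: e, g, f & E].
  rewrite perm_sym; apply: perm_trans (_ : perm_eq [:: e, f, g & E] _).
    by rewrite perm_cons; apply/permPl; apply: (perm_catCA [:: g] [:: f]).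
  by apply/permPl; apply: (perm_catCA [:: e] [:: f; g]).
rewrite /= !renameM !rename_gen.
apply: gtrans (graph_perm (pm _ _ _ _)) (gtrans _ (gsym (graph_perm (pm _ _ _ _)))).
exact: suffix.
Qed.

Lemma slide_word V (a b c d : V) (w p x : freegroup V) F :
  WGraph [:: (a, b, w), (c, d, p * x) & F] ~~>
  WGraph [:: (a, b, w),
    (c, d, p * lift_free (fun y => if y == b then gen a ^ w else gen y) x) & F].
Proof.
elim/freegroup_ind: x p => [|[e x] y _ IHy] p; first by rewrite lift_free1.
rewrite mulgA; apply: gtrans (IHy _) _; rewrite lift_freeM mulgA.
set y' := lift_free _ y; rewrite /glet /lval /=.
(* The letter b^-1 becomes b once the edge is reversed. *)
case: e; rewrite ?lift_freeV lift_gen; case: eqP => // ->; last exact: slide.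
apply: gtrans (graph_flip2 _ _ _ _ _) _; apply: gtrans _ (gsym (graph_flip2 _ _ _ _ _)).
have inv_mid v : (p * v^-1 * y')^-1 = y'^-1 * v * p^-1 by rewrite !invgM invgK mulgA.
by rewrite !inv_mid; apply: slide.
Qed.

(** The edge (a, b, w) imposes b = a^w. *)
Lemma graph_subst V (a b : V) w (E : seq (edge V)) :
  WGraph ((a, b, w) :: E) ~~>
  WGraph ((a, b, w) ::
    [seq (e.1, lift_free (fun y => if y == b then gen a ^ w else gen y) e.2)
      | e <- E]).
Proof.
set h := fun e : edge V => _; have := @graph_map _ [:: (a, b, w)] h E [::].
rewrite /= !cats0; apply => [[[c d] x] F _].
by have := slide_word a b c d w 1 x F; rewrite !mul1g.
Qed.

Lemma graph_R1 V (a b : V) v w F :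
    all (fun l => l.2 == a) (fword v) ->
  WGraph ((a, b, w) :: F) ~~> WGraph ((a, b, v * w) :: F).
Proof.
elim/freegroup_ind: v => [_|[e x] v Ev IHv]; first by rewrite mul1g.
rewrite Ev /= => /andP[/eqP-> /IHv E]; apply: gtrans E _; rewrite -mulgA.
exact/gstep/WR1.
Qed.

Lemma graph_R1_target V (a b : V) v w F :
    all (fun l => l.2 == b) (fword v) ->
  WGraph ((a, b, w) :: F) ~~> WGraph ((a, b, w * v^-1) :: F).
Proof.
move=> vb; apply: gtrans (graph_flip _ _ _ _) (gtrans (graph_R1 _ _ _ vb) _).
by apply: gtrans (graph_flip _ _ _ _) _; rewrite invgM invgK.
Qed.

End Sliding.

(** * Substituting a conjugate for a vertex *)

(** A relation j^-1 i^w becomes j^-1 i^z, with the decoration z below, when b^u is substituted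
    for b and the result is conjugated back if j = b. *)
Definition edge_conj (V : choiceType) (b : V) (u : freegroup V) (e : edge V) : edge V :=
  (e.1, (if e.1.1 == b then u else 1) * conj_gen b u e.2 *
        (if e.1.2 == b then u^-1 else 1)).

Section Conjugation.
Implicit Types V : finType.

(** The new vertex None takes over the role of b: after stabilization the edge from
    None to b says that b is None^u, and once the decorations are rewritten
    accordingly, b is itself in a position to be stabilized by u, which empties
    that edge. *)
Lemma graph_conj_out V (b : V) u (E : seq (edge V)) :
    avoids b u -> {in E, forall e, e.1.2 != b} ->
  WGraph E ~~> WGraph [seq edge_conj b u e | e <- E].
Proof.
move=> bu Eb; pose E' := [seq edge_map Some e | e <- E].
pose u' := rename Some u.
have u'b : avoids (Some b) u' by apply: avoids_rename_inj => // x y [].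
(* Hang None on b by an empty edge and stabilize at None. *)
rewrite {1}(_ : E = [seq edge_map (odflt b) e | e <- E']); last by rewrite map_edge_mapK.
apply: gtrans (gsym (uncontract _ _)) _.
apply: gtrans (stabilize (avoids_None u) _ _) _.
- by move=> e; rewrite !inE => /orP[/eqP->|/mapP[? _ ->]].
- by move=> e; rewrite !inE => /orP[/eqP->|/mapP[? _ ->]] //=; exact: avoids_None.
have -> : [seq prefix_at None u' e | e <- (None, Some b, 1) :: E'] = (None, Some b, u') :: E'.
  rewrite /=; congr (_ :: _); first by rewrite /prefix_at /= mulg1.
  apply: map_id_in.
  by move=> e /mapP[f _ ->]; rewrite prefix_at_neq.
 apply: gtrans (graph_subst _ _ _ _) _.
set psi := lift_free _; set E'' := map _ E'.
(* Stabilize at b, which empties the edge again, and contract. *)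
apply: gtrans (graph_flip _ _ _ _) _.
apply: gtrans (stabilize u'b _ _) _.
- move=> e; rewrite !inE => /orP[/eqP->|/mapP[f /mapP[g gE ->] ->]] //=.
  exact: contra (Eb g gE) => /eqP[->].
- move=> e; rewrite !inE => /orP[/eqP->|/mapP[f /mapP[g gE ->] ->]] /=; first exact: avoidsV.
  apply: avoids_lift => x; case: ifP => [_|/negbT]; last by rewrite avoids_gen.
  by rewrite conjgE !avoidsM ?avoidsV ?avoids_gen.
rewrite /= {1}/prefix_at /= eqxx mulgV.
apply: gtrans (graph_flip _ _ _ _) _; rewrite invg1.
apply: gtrans (uncontract _ _) _.
rewrite /E'' /E' -!map_comp (_ : map _ E = [seq edge_conj b u e | e <- E]) //.
apply/eq_in_map => -[[i j] w] eE; have /negPf jb := Eb _ eE.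
rewrite /edge_map /edge_conj /= jb mulg1 /= (inj_eq Some_inj); congr (_, _).
have psiE : rename (odflt b) (psi (rename Some w)) = conj_gen b u w.
  rewrite /psi lift_free_rename rename_lift_free; apply: lift_free_ext => x /=.
  rewrite (inj_eq Some_inj); case: eqP => [->|_]; last by rewrite rename_gen.
  by rewrite !conjgE !renameM renameV rename_gen /u' rename_comp rename_id.
by case: eqP => _; rewrite ?renameM psiE ?mul1g // /u' rename_comp rename_id.
Qed.

Lemma conj_gen_rename (V W : choiceType) (f : V -> W) b u w : injective f ->
  conj_gen (f b) (rename f u) (rename f w) = rename f (conj_gen b u w).
Proof.
move=> f_inj; rewrite /conj_gen lift_free_rename rename_lift_free.
apply: lift_free_ext => x /=; rewrite (inj_eq f_inj).
by case: ifP; rewrite ?conjgE ?renameM ?renameV ?rename_gen.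
Qed.

Lemma edge_conj_map (V W : choiceType) (f : V -> W) b u e : injective f ->
  edge_conj (f b) (rename f u) (edge_map f e) = edge_map f (edge_conj b u e).
Proof.
move=> f_inj; case: e => [[i j] w].
rewrite /edge_map /edge_conj /= !(inj_eq f_inj) conj_gen_rename //; congr (_, _).
by rewrite !renameM; case: (i == b); case: (j == b); rewrite ?renameV ?rename1.
Qed.

(** Induction on the number of edges ending in b: subdividing such an edge by an empty
    one, which is then reversed to leave b, lowers that number.  This covers the
    loops at b, which cannot be made to point outwards by a reversal. *)
Lemma graph_conj_avoids V (b : V) u (E : seq (edge V)) :
  avoids b u -> WGraph E ~~> WGraph [seq edge_conj b u e | e <- E].
Proof.
have [n] := ubnP (count (fun e => e.1.2 == b) E).
elim: n V b u E => // n IHn V b u E leEn bu.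
have [/hasP[e eE /eqP eb]|/hasPn] := boolP (has (fun e => e.1.2 == b) E); last first.
  exact: graph_conj_out.
have pE := perm_to_rem eE; move: (rem e E) pE leEn => F pE.
rewrite (permP pE) /= eb eqxx add1n ltnS => ltFn.
apply: gtrans (graph_perm pE) (gtrans _ (gsym (graph_perm (perm_map _ pE)))).
case: e eb {eE pE} => [[i j] w] /= ->; rewrite -{1}[w]mulg1.
set u' := rename Some u; set w' := rename Some w.
pose F' := map (edge_map Some) F.
apply: gtrans (graph_split _ _ _ _ _) (gtrans (graph_flip2 _ _ _ _ _) _).
apply: gtrans (IHn (option V) (Some b) u' _ _ _) _.
(* The first edge now ends in None, the second one starts at b. *)
- rewrite /= !add0n count_map; apply: leq_ltn_trans ltFn; rewrite leq_eqVlt; apply/orP; left.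
  by apply/eqP; apply: eq_count => e /=; rewrite (inj_eq Some_inj).
- exact: avoids_rename_inj Some_inj bu.
pose v := (if i == b then u else 1) * conj_gen b u w.
have -> : [seq edge_conj (Some b) u' e
      | e <- [:: (Some i, None, w'), (Some b, None, (rename Some 1)^-1) & F']] =
    [:: (Some i, None, rename Some v), (Some b, None, u')
      & [seq edge_map Some e | e <- [seq edge_conj b u e | e <- F]]].
  rewrite /= {1 2}/edge_conj /= eqxx (inj_eq Some_inj) !mulg1.
  rewrite conj_gen_rename; last exact: Some_inj.
  rewrite rename1 invg1 [conj_gen _ _ 1]lift_free1 mulg1.
  congr (_ :: _); [congr (_, _) | congr (_ :: _)].
    by rewrite /v renameM; case: ifP; rewrite ?rename1.
  by rewrite -!map_comp; apply: eq_map => e; exact: edge_conj_map Some_inj.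
apply: gtrans (graph_flip2 _ _ _ _ _) _.
rewrite -renameV; apply: gtrans (gsym (graph_split _ _ _ _ _)) _.
by rewrite [_ (i, b, w)]/(edge_conj b u (i, b, w)) /edge_conj /= eqxx.
Qed.

(** Conjugating b by itself changes no word, only the bookkeeping factors b^(+-1) at
    the two ends of the decorations, which R1 absorbs. *)
Lemma graph_conj_self V (b : V) eps (E : seq (edge V)) :
  WGraph E ~~> WGraph [seq edge_conj b (glet (eps, b)) e | e <- E].
Proof.
have := @graph_map V [::] (edge_conj b (glet (eps, b))) E [::].
rewrite !cats0; apply => -[[i j] w] F _ /=.
have -> : edge_conj b (glet (eps, b)) (i, j, w) = (i, j,
    (if i == b then glet (eps, b) else 1) * w * (if j == b then glet (eps, b) else 1)^-1).
  rewrite /edge_conj /=; congr (_, _ * _ * _); last by case: ifP; rewrite ?invg1.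
  rewrite -[RHS]lift_free_gen; apply: lift_free_ext => x; case: eqP => // ->.
  rewrite conjgE /glet /lval /=; case: eps; first by rewrite invgK mulgV mulg1.
  by rewrite mulKg.
apply: gtrans (graph_R1 _ _ _ (_ : all _ (fword (if i == b then glet (eps, b) else 1)))) _.
  by case: eqP => [->|//]; rewrite fword_glet /= eqxx.
apply: graph_R1_target.
by case: eqP => [->|//]; rewrite fword_glet /= eqxx.
Qed.

Lemma graph_conj V (b : V) (l : letter V) (E : seq (edge V)) :
  WGraph E ~~> WGraph [seq edge_conj b (glet l) e | e <- E].
Proof.
case: (eqVneq l.2 b) => [<-|lb]; first by case: l => eps c; apply: graph_conj_self.
by apply: graph_conj_avoids; rewrite avoidsE fword_glet /= lb.
Qed.

End Conjugation.

(** * From edges to relations *)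

Section Relations.
Variable X : choiceType.
Implicit Types e : edge X.

Definition edge_rel e : wrelation X := wrel e.1.1 e.1.2 e.2.

(** The exponent is chosen as a function of the relation alone, so that edges with the
    same relation yield the same edge: it serves as a normal form. *)
Definition rel_edge (r : wrelation X) : edge X :=
  (r.1, if pselect (exists w, r == wrel r.1.1 r.1.2 w) is left h then xchoose h else 1).

Lemma rel_edgeK r : (exists w, r = wrel r.1.1 r.1.2 w) -> edge_rel (rel_edge r) = r.
Proof.
case=> w rw; apply: esym; apply/eqP; rewrite /edge_rel /rel_edge /=.
case: pselect => [h|[]]; first exact: xchooseP h.
by exists w; apply/eqP.
Qed.

Lemma wrel_eq_exponents (i j : X) (w w' : freegroup X) :
  wrel i j w = wrel i j w' -> all (fun l => l.2 == i) (fword (w' * w^-1)).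
Proof.
move=> ij; have E : gen i ^ w = gen i ^ w' by apply/(mulgI (gen j)^-1)/(congr1 snd ij).
apply: centraliser_gen.
by rewrite conjgM -E conjgK.
Qed.

End Relations.

Lemma wrel_R1 (X : choiceType) (i j : X) eps w : wrel i j (glet (eps, i) * w) = wrel i j w.
Proof.
rewrite /wrel conjgM; congr (_, _ * _ ^ _).
by rewrite conjgE /glet /lval; case: eps; rewrite /= ?mulKg // invgK mulgV mulg1.
Qed.

Lemma rel_rename_comp (U V W : choiceType) (f : U -> V) (g : V -> W) r :
  rel_rename g (rel_rename f r) = rel_rename (g \o f) r.
Proof. by rewrite /rel_rename /= rename_comp. Qed.

Lemma rel_rename_id (V : choiceType) (f : V -> V) r : f =1 id -> rel_rename f r = r.
Proof. by case: r => [[i j] w] fid; rewrite /rel_rename /= !fid rename_id. Qed.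

Lemma edge_rel_map (X Y : choiceType) (f : X -> Y) e :
  edge_rel (edge_map f e) = rel_rename f (edge_rel e).
Proof.
by rewrite /edge_rel /edge_map /rel_rename /wrel /= ?conjgE !(renameM, renameV, rename_gen).
Qed.

Lemma edge_rel_conj (X : choiceType) (b : X) u e :
  edge_rel (edge_conj b u e) = rel_conj_gen b u (edge_rel e).
Proof. by rewrite /edge_rel rel_conj_gen_wrel. Qed.

Notation rels_of E := (map (@edge_rel _) E).
Notation emap f E := (map (edge_map f) E).

(** The only ambiguity in w is a power of the source vertex, which R1 removes. *)
Lemma graph_rel_edge (V : finType) (E : seq (edge V)) :
  WGraph E ~~> WGraph (map (@rel_edge V) (rels_of E)).
Proof.
rewrite -map_comp; have := @graph_map V [::] (@rel_edge V \o @edge_rel V) E [::].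
rewrite !cats0; apply => -[[i j] w] F _ /=.
have := @rel_edgeK V (edge_rel (i, j, w)) (ex_intro _ w erefl).
set w' := (rel_edge (edge_rel (i, j, w))).2 => E'.
have {}E' : wrel i j w = wrel i j w' := esym E'.
have /graph_R1 := wrel_eq_exponents E'.
by move=> /(_ j w F); rewrite mulgVK.
Qed.

(** * The correspondence and its compatibility with the moves *)

Definition pres_of_edges k (E : seq (edge 'I_k)) : wpres.
Proof.
apply: (@WPres k (rels_of E)) => r /mapP[[[i j] w] _ ->]; by exists w.
Defined.

Lemma pres_psort k k' (r : seq (wrelation 'I_k)) (s : seq (wrelation 'I_k')) hr hs
   (f : 'I_k -> 'I_k') :
  bijective f -> perm_eq s [seq rel_rename f q | q <- r] ->
  wpres_equiv (@WPres k r hr) (@WPres k' s hs).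
Proof.
move=> f_bij; have kk : k = k' by rewrite -[k]card_ord -[k']card_ord (bij_eq_card f_bij).
by subst k' => rs; apply/rst_step/(Psort _ _ f_bij).
Qed.

Lemma rels_of_surj k (r : seq (wrelation 'I_k)) :
    (forall q, q \in r -> exists w, q = wrel q.1.1 q.1.2 w) ->
  exists E, r = rels_of E.
Proof.
move=> hr; exists (map (@rel_edge _) r); rewrite -map_comp map_id_in // => q qr /=.
by rewrite rel_edgeK //; apply: hr.
Qed.

Lemma correspondsE G P : corresponds G P <->
  exists2 nu : vertex G -> 'I_(ngen P), bijective nu &
    perm_eq (rels P) (rels_of (emap nu (edges G))).
Proof.
by split=> -[nu nu_bij E]; exists nu => //; move: E; rewrite -map_comp.
Qed.

Lemma corresponds_edges k (E : seq (edge 'I_k)) hr :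
  corresponds (WGraph E) (@WPres k (rels_of E) hr).
Proof.
apply/correspondsE; exists id => /=; first by exists id.
have -> // : emap id E = E by apply: map_id_in => e _; apply: edge_map_id.
Qed.

Lemma corresponds_numbering (G : wgraph) k (nu : vertex G -> 'I_k) : bijective nu ->
  corresponds G (pres_of_edges (emap nu (edges G))).
Proof. by move=> nu_bij; apply/correspondsE; exists nu. Qed.

Lemma corresponds_total G : exists P, corresponds G P.
Proof.
exists (pres_of_edges (emap enum_rank (edges G))).
exact/corresponds_numbering/enum_rank_bij.
Qed.

Lemma corresponds_surj P : exists G, corresponds G P.
Proof.
case: P => k r hr; have [E rE] := rels_of_surj hr; subst r.
by exists (WGraph E); apply: corresponds_edges.
Qed.

(** Two numberings of the same vertices differ by a permutation of the generators. *)
Lemma corresponds_pres_uniq G P P' : corresponds G P -> corresponds G P' -> wpres_equiv P P'.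
Proof.
move=> /correspondsE[nu [nui nuK nuiK] E] /correspondsE[mu mu_bij E'].
case: P P' nu nui nuK nuiK E mu mu_bij E' => [k r hr] [k' s hs] /=.
move=> nu nui nuK nuiK E mu mu_bij E'.
apply: (@pres_psort _ _ _ _ _ _ (mu \o nui)).
  by apply: bij_comp => //; exists nu.
apply: perm_trans E' _; rewrite perm_sym; apply: perm_trans (perm_map _ E) _.
rewrite -!map_comp (@eq_map _ _ _ (@edge_rel _ \o edge_map mu)) // => e /=.
rewrite -edge_rel_map edge_map_comp; congr (edge_rel _).
case: e => [[i j] w]; rewrite /edge_map /= !nuK; congr (_, _).
by apply: lift_free_ext => x /=; rewrite nuK.
Qed.

(** Both graphs can be carried to the vertex set 'I_k, where normalizing their edges
    yields the same list up to order. *)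
Lemma corresponds_graph_uniq G G' P : corresponds G P -> corresponds G' P -> G ~~> G'.
Proof.
case: P => k r hr.
have norm H : corresponds H (@WPres k r hr) -> H ~~> WGraph (map (@rel_edge _) r).
  case: H => V E /correspondsE[/= nu nu_bij EE].
  apply: gtrans (_ : _ ~~> WGraph (emap nu E)) _.
    by apply/gstep/(@Wiso _ _ _ _ nu).
  apply: gtrans (graph_rel_edge _) (graph_perm _).
  by apply: perm_map; rewrite perm_sym.
by move=> /norm GP /norm GP'; apply: gtrans GP (gsym GP').
Qed.

Lemma numbering (V : finType) : exists k (nu : V -> 'I_k), bijective nu.
Proof. by exists #|V|, enum_rank; apply: enum_rank_bij. Qed.

Lemma pres_step k k' (E : seq (edge 'I_k)) (E' : seq (edge 'I_k')) :
  (forall r s hr hs, r = rels_of E -> s = rels_of E' ->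
    wpres_move (@WPres k r hr) (@WPres k' s hs)) ->
  wpres_equiv (pres_of_edges E) (pres_of_edges E').
Proof. by move=> h; apply: rst_step; apply: h. Qed.

(** By uniqueness up to equivalence, numberings can be chosen to suit each move. *)
Lemma graph_move_pres G G' : wgraph_move G G' -> exists P P',
  [/\ corresponds G P, corresponds G' P' & wpres_equiv P P'].
Proof.
have same (V : finType) (E E' : seq (edge V)) :
    (forall k (nu : V -> 'I_k), bijective nu ->
      wpres_equiv (pres_of_edges (emap nu E)) (pres_of_edges (emap nu E'))) ->
    exists P P', [/\ corresponds (WGraph E) P, corresponds (WGraph E') P'
                   & wpres_equiv P P'].
  have [k [nu nu_bij]] := numbering V => h.
  exists (pres_of_edges (emap nu E)), (pres_of_edges (emap nu E')).
  by split; [exact: corresponds_numbering..|exact: h].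
case=> {G G'}.
- move=> V W E E' f f_bij EE'; have [k [nu nu_bij]] := numbering W.
  exists (pres_of_edges (emap (nu \o f) E)), (pres_of_edges (emap nu E')); split.
  + by apply: corresponds_numbering; apply: bij_comp.
  + exact: corresponds_numbering.
  + apply: (@pres_psort _ _ _ _ _ _ id); first by exists id.
    apply: perm_trans (perm_map _ (perm_map _ EE')) _.
    have <- : rels_of (emap nu (emap f E)) = map (rel_rename id) (rels_of (emap (nu \o f) E)).
      by rewrite -!map_comp; apply: eq_map => e /=; rewrite rel_rename_id // edge_map_comp.
    exact: perm_refl.
- move=> V W a b E p ab p_surj pP.
  have [k [nu nu_bij]] := numbering W.
  (* Number b last, and the other vertices as in the quotient. *)
  pose mu x := if x == b then ord_max else lift ord_max (nu (p x)).
  have pab : p a = p b by apply/pP; constructor 2.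
  have mu_inj : injective mu.
    move=> x y; rewrite /mu; case: eqVneq => [->|xb]; case: eqVneq => [->|yb] //.
    - by move/eqP; rewrite (negPf (neq_lift _ _)).
    - by move/eqP; rewrite eq_sym (negPf (neq_lift _ _)).
    move/lift_inj/(bij_inj nu_bij)/pP => [//|[_ E']|[E' _]].
      by rewrite E' eqxx in yb.
    by rewrite E' eqxx in xb.
  have mu_bij : bijective mu.
    have muK z : exists x, mu x = z.
      case: (unliftP ord_max z) => [y ->|->]; last by exists b; rewrite /mu eqxx.
      have [nui _ nuiK] := nu_bij; have [x px] := p_surj (nui y).
      case: (eqVneq x b) px => [->|xb] px.
        by exists a; rewrite /mu (negPf ab) pab px nuiK.
      by exists x; rewrite /mu (negPf xb) px nuiK.
    by have [mui muiK] := choice muK; exists mui => //; apply: inj_can_sym.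
  exists (pres_of_edges (emap mu ((a, b, 1) :: E))), (pres_of_edges (emap nu (emap p E))).
  split; [exact: corresponds_numbering..|].
  apply: pres_step => r s hr hs; rewrite /= {1}/edge_rel /= rename1 => rE sE; subst r s.
  apply: Pmerge.
    by rewrite (inj_eq (bij_inj mu_bij)).
  rewrite -!map_comp; apply: eq_map => e /=.
  rewrite -!edge_rel_map !edge_map_comp; congr edge_rel.
  apply: eq_edge_map => x /=; rewrite (inj_eq mu_inj) /mu (negPf ab).
  by rewrite eqxx; case: eqP => // ->; rewrite pab.
- move=> V a b w E; apply: same => k nu nu_bij.
  apply: pres_step => r s hr hs; rewrite /= {1 3}/edge_rel /= renameV => rE sE; subst r s.
  exact: Pflip.
- move=> V b l E Eb Ea; apply: same => k nu nu_bij.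
  apply: pres_step => r s hr hs rE sE; move: hs.
  have -> : s = [seq rel_conj_gen (nu b) (glet (l.1, nu l.2)) q | q <- r]; last exact: Pconj.
  rewrite sE rE -!map_comp; apply/eq_in_map => e eE /=.
  have nu_inj := bij_inj nu_bij.
  rewrite -edge_rel_conj -rename_glet edge_conj_map //; congr (edge_rel (edge_map nu _)).
  have /negPf eb := Eb e eE.
  rewrite /edge_conj /prefix_at eb mulg1 conj_gen_avoids ?Ea //.
  by case: eqP; rewrite ?mul1g.
- move=> V a b w eps E; apply: same => k nu nu_bij.
  apply: (@pres_psort _ _ _ _ _ _ id); first by exists id.
  have -> : rels_of (emap nu ((a, b, glet (eps, a) * w) :: E)) =
            rels_of (emap nu ((a, b, w) :: E)).
    by rewrite /= {1 3}/edge_rel /= renameM rename_glet wrel_R1.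
  have -> : map (rel_rename id) (rels_of (emap nu ((a, b, w) :: E))) =
            rels_of (emap nu ((a, b, w) :: E)).
    by apply: map_id_in => q _; apply: rel_rename_id.
  exact: perm_refl.
- move=> V a b c d w E; apply: same => k nu nu_bij.
  apply: pres_step => r s hr hs; rewrite /= {1 2 4 5}/edge_rel /=.
  rewrite !renameM !rename_gen => rE sE; subst r s.
  exact: Pslide.
Qed.

Lemma pres_move_graph P P' : wpres_move P P' -> exists G G',
  [/\ corresponds G P, corresponds G' P' & G ~~> G'].
Proof.
have tl (T : eqType) (Q : T -> Prop) x s :
    (forall q, q \in x :: s -> Q q) -> forall q, q \in s -> Q q.
  by move=> h q qs; apply: h; rewrite inE qs orbT.
have same k (E E' : seq (edge 'I_k)) r r' hr hr' :
    r = rels_of E -> r' = rels_of E' -> WGraph E ~~> WGraph E' ->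
    exists G G', [/\ corresponds G (@WPres k r hr),
                     corresponds G' (@WPres k r' hr') & G ~~> G'].
  move=> rE rE'; subst; exists (WGraph E), (WGraph E').
  by split=> //; apply: corresponds_edges.
case=> {P P'}.
- move=> k r s hr hs f f_bij rs; have [E rE] := rels_of_surj hr; subst r.
  exists (WGraph E), (WGraph (emap f E)); split; first exact: corresponds_edges.
    apply/correspondsE; exists id; first by exists id.
    have -> : rels_of (emap id (emap f E)) = map (rel_rename f) (rels_of E); last exact: rs.
    rewrite -!map_comp; apply: eq_map => e /=.
    by rewrite [edge_map id _]edge_map_id // edge_rel_map.
  by apply/gstep/Wiso => //.
- move=> k i1 i2 r s hr hs i12 srE.
  have [E rE] := rels_of_surj (tl _ _ _ _ hr); subst r.
  have [i0 i1E] : exists i0, i1 = lift i2 i0.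
    by move: i12; rewrite eq_sym => /unlift_some[i0 i1E _]; exists i0.
  (* The quotient map identifying i1 and i2, with values in 'I_k. *)
  pose p x := odflt i0 (unlift i2 x).
  have pl y : p (lift i2 y) = y by rewrite /p liftK.
  have p2 : p i2 = i0 by rewrite /p unlift_none.
  have sE : s = rels_of (emap p E).
    have -> : s = map (rel_rename p) (map (rel_rename (lift i2)) s).
      by rewrite -map_comp map_id_in // => q _ /=; rewrite rel_rename_comp rel_rename_id.
    rewrite srE -!map_comp; apply: eq_map => e /=.
    rewrite -!edge_rel_map !edge_map_comp; congr edge_rel.
    by apply: eq_edge_map => x /=; case: eqP => // ->; rewrite i1E pl p2.
  exists (WGraph ((i1, i2, 1) :: E)), (WGraph (emap p E)); split.
  + exact: (@corresponds_edges _ ((i1, i2, 1) :: E)).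
  + by subst s; apply: corresponds_edges.
  + apply/gstep/WC => // [y|x y]; first by exists (lift i2 y).
    split; last by case=> [->|[-> ->]|[-> ->]]; rewrite // i1E pl p2.
    case: (unliftP i2 x) => [x' ->|->]; case: (unliftP i2 y) => [y' ->|->];
      rewrite ?pl ?p2 i1E.
    * by move=> ->; constructor 1.
    * by move=> ->; constructor 2.
    * by move=> <-; constructor 3.
    * by constructor 1.
- move=> k i1 i2 w r hr hs; have [E rE] := rels_of_surj (tl _ _ _ _ hr); subst r.
  apply: (@same _ ((i2, i1, w) :: E) ((i1, i2, w^-1) :: E)) => //.
  exact: graph_flip.
- move=> k b l r hr hs; have [E rE] := rels_of_surj hr; subst r.
  apply: (@same _ E (map (edge_conj b (glet l)) E)) => //; last exact: graph_conj.
  by rewrite -!map_comp; apply: eq_map => e /=; rewrite edge_rel_conj.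
- move=> k i1 i2 i3 i4 w r hr hs.
  have [E rE] := rels_of_surj (tl _ _ _ _ (tl _ _ _ _ hr)); subst r.
  apply: (@same _ [:: (i1, i2, w), (i3, i4, gen i1 * w) & E]
                  [:: (i1, i2, w), (i3, i4, w * gen i2) & E]) => //.
  exact/gstep/WR3.
Qed.

(** * Bijections between sets of classes *)

Lemma class_rep (T : Type) (m : T -> T -> Prop)
    (c : classes (clos_refl_sym_trans T m)) :
  exists x, in_class x c.
Proof. by case: c => C [x cx]; exists x; rewrite /in_class /= cx; apply: rst_refl. Qed.

Lemma class_surj (T : Type) (m : T -> T -> Prop) (x : T) :
  exists c : classes (clos_refl_sym_trans T m), in_class x c.
Proof.
by exists (exist _ (clos_refl_sym_trans T m x) (ex_intro _ x erefl)); apply: rst_refl.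
Qed.

Lemma class_rel (T : Type) (m : T -> T -> Prop)
    (c : classes (clos_refl_sym_trans T m)) x y :
  in_class x c -> in_class y c -> clos_refl_sym_trans T m x y.
Proof.
case: c => C [z Cz]; rewrite /in_class /= Cz => zx zy.
exact: rst_trans (rst_sym _ _ _ _ zx) zy.
Qed.

Lemma class_eq (T : Type) (m : T -> T -> Prop)
    (c d : classes (clos_refl_sym_trans T m)) x y :
  in_class x c -> in_class y d -> clos_refl_sym_trans T m x y -> c = d.
Proof.
case: c d => C hC [D hD]; rewrite /in_class /= => Cx Dy xy.
suff E : C = D by subst D; congr exist; apply: Prop_irrelevance.
case: hC hD Cx Dy => [x0 ->] [y0 ->] x0x y0y; have x0y := rst_trans _ _ _ _ _ x0x xy.
have x0y0 := rst_trans _ _ _ _ _ x0y (rst_sym _ _ _ _ y0y).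
apply: funext => z; apply: propext; split=> h; last exact: rst_trans x0y0 h.
exact: rst_trans (rst_sym _ _ _ _ x0y0) h.
Qed.

(** A zigzag of moves is followed step by step: each intermediate point has some
    correspondent by totality, and the choice does not matter by uniqueness. *)
Lemma transfer_closure (A B : Type) (mA : A -> A -> Prop) (RB : B -> B -> Prop)
    (C : A -> B -> Prop) :
    (forall y y', RB y y' -> RB y' y) ->
    (forall y y' y'', RB y y' -> RB y' y'' -> RB y y'') ->
    (forall x, exists y, C x y) ->
    (forall x y y', C x y -> C x y' -> RB y y') ->
    (forall x x', mA x x' -> exists y y', [/\ C x y, C x' y' & RB y y']) ->
  forall x x', clos_refl_sym_trans A mA x x' ->
  forall y y', C x y -> C x' y' -> RB y y'.
Proof.
move=> sym trans total uniq step x x'; elim=> {x x'}.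
- move=> x x' /step[z [z' [Cz Cz' zz']]] y y' Cy Cy'.
  exact: trans (uniq _ _ _ Cy Cz) (trans _ _ _ zz' (uniq _ _ _ Cz' Cy')).
- exact: uniq.
- by move=> x x' _ IH y y' Cy Cy'; apply/sym/IH.
- move=> x x' x'' _ IH _ IH' y y'' Cy Cy''; have [y' Cy'] := total x'.
  exact: trans (IH _ _ Cy Cy') (IH' _ _ Cy' Cy'').
Qed.

(** Choice selects a class of B for each class of A and conversely; compatibility
    makes these classes unique, so the two functions are mutually inverse. *)
Lemma class_bijection (A B : Type) (mA : A -> A -> Prop) (mB : B -> B -> Prop)
    (C : A -> B -> Prop) :
    let RA := clos_refl_sym_trans A mA in let RB := clos_refl_sym_trans B mB in
    (forall x, exists y, C x y) -> (forall y, exists x, C x y) ->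
    (forall x x', RA x x' -> forall y y', C x y -> C x' y' -> RB y y') ->
    (forall y y', RB y y' -> forall x x', C x y -> C x' y' -> RA x x') ->
  exists f : classes RA -> classes RB, bijective f /\
    forall c d, f c = d <->
      exists x y, [/\ in_class x c, in_class y d & C x y].
Proof.
move=> RA RB totA totB AB BA.
pose rel c d := exists x y, [/\ @in_class _ RA x c, @in_class _ RB y d & C x y].
have /choice[f relf] : forall c, exists d, rel c d.
  move=> c; have [x cx] := class_rep c; have [y Cxy] := totA x.
  by have [d dy] := class_surj mB y; exists d, x, y.
have /choice[g relg] : forall d, exists c, rel c d.
  move=> d.
  have [y dy] := class_rep d; have [x Cxy] := totB y.
  by have [c cx] := class_surj mA x; exists c, x, y.
have fP c d : f c = d <-> rel c d.
  split=> [<-|[x [y [cx dy Cxy]]]]; first exact: relf.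
  have [x' [y' [cx' dy' Cxy']]] := relf c.
  exact: class_eq dy' dy (AB _ _ (class_rel cx' cx) _ _ Cxy' Cxy).
exists f; split=> //; exists g => [c|d]; last exact/fP/relg.
have [x [y [cx dy Cxy]]] := relf c; have [x' [y' [cx' dy' Cxy']]] := relg (f c).
exact: class_eq cx' cx (BA _ _ (class_rel dy' dy) _ _ Cxy' Cxy).
Qed.

Theorem proposition2p2 :
  exists f : welded_graph -> wirtinger_class,
    bijective f /\
    forall (c : welded_graph) (d : wirtinger_class),
      f c = d <->
      exists (G : wgraph) (P : wpres),
        [/\ in_class G c, in_class P d & corresponds G P].
Proof.
apply: class_bijection.
- exact: corresponds_total.
- exact: corresponds_surj.
- exact: (transfer_closure (@rst_sym _ _) (@rst_trans _ _) corresponds_total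
           corresponds_pres_uniq graph_move_pres).
- apply: (transfer_closure (C := fun P G => corresponds G P) (@rst_sym _ _)
            (@rst_trans _ _) corresponds_surj).
    by move=> P G G'; apply: corresponds_graph_uniq.
  exact: pres_move_graph.
Qed.
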